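(* Let $M\ge 1$ be an integer, $\varrho\ge 0$ a real number, and let $\mathbf{\Phi}_g,\mathbf{\Lambda}_g\in\mathbb{C}^{2M\times M}$ be given matrices. Consider the optimization problem over $\mathbf{\Theta}_g\in\mathbb{C}^{2M\times M}$ $$\min_{\mathbf{\Theta}_g}\ \Re\{\mathrm{Tr}(\mathbf{\Lambda}_g^H(\mathbf{\Phi}_g-\mathbf{\Theta}_g))\}+\frac{\varrho}{2}\|\mathbf{\Phi}_g-\mathbf{\Theta}_g\|_F^2\quad\text{subject to}\quad \mathbf{\Theta}_g^H\mathbf{\Theta}_g=\mathbf{I}_M .$$ With this orthogonality constraint, the optimal solution for $\mathbf{\Theta}_g$ is given by $$\mathbf{\Theta}_g=\mathbf{B}_g\,[\mathbf{I}_{M\times M},\mathbf{0}_{M\times M}]^T\,\mathbf{D}_g^H ,$$ where $\mathbf{B}_g\mathbf{\Sigma}_g\mathbf{D}_g^H=\mathbf{\Lambda}_g+\varrho\mathbf{\Phi}_g$ is the singular value decomposition of $\mathbf{\Lambda}_g+\varrho\mathbf{\Phi}_g$.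
   Context: $(\cdot)^H$ is the conjugate transpose, $(\cdot)^T$ the transpose, $\|\cdot\|_F$ the Frobenius norm, $\mathrm{Tr}$ the trace, $\Re$ the real part, and $\mathbf{I}_M=\mathbf{I}_{M\times M}$ the $M\times M$ identity matrix. The singular value decomposition is the full one: $\mathbf{B}_g\in\mathbb{C}^{2M\times 2M}$ and $\mathbf{D}_g\in\mathbb{C}^{M\times M}$ are unitary, and $\mathbf{\Sigma}_g\in\mathbb{R}^{2M\times M}$ has the nonnegative singular values on its main diagonal and zeros elsewhere. The matrix $[\mathbf{I}_{M\times M},\mathbf{0}_{M\times M}]^T$ is the $2M\times M$ matrix whose top block is the identity and whose bottom block is zero. *)

(* Defs.v *)
From mathcomp Require Export all_boot all_order all_algebra.
From mathcomp Require Export reals.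
From mathcomp Require Export complex.

Set Implicit Arguments.
Unset Strict Implicit.
Unset Printing Implicit Defensive.

Import Order.TTheory GRing.Theory Num.Theory Num.Def.

Local Open Scope ring_scope.
Local Open Scope complex_scope.
Local Open Scope sesquilinear_scope.

Section Defs.
Variable R : realType.
Local Notation C := R[i].

Definition frobenius_norm (m n : nat) (A : 'M[C]_(m, n)) : R :=
  Num.sqrt (\sum_i \sum_j ComplexField.Normc.normc (A i j) ^+ 2).

(* Full SVD: the singular values are nonnegative but not required to be
   sorted.  The matrix Sigma is rectangular, and is_diag_mx makes it zero off
   its main diagonal; nonnegativity of all its entries is thus nonnegativity
   of the singular values. *)
Definition is_svd (m n : nat) (A : 'M[C]_(m, n))
    (B : 'M[C]_m) (Sigma : 'M[R]_(m, n)) (D : 'M[C]_n) : Prop :=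
  [/\ B \is unitarymx, D \is unitarymx,
      is_diag_mx Sigma,
      forall i j, 0 <= Sigma i j &
      B *m map_mx (real_complex R) Sigma *m D ^t* = A].

Definition objective (m n : nat) (rho : R) (Phi Lambda Theta : 'M[C]_(m, n)) : R :=
  complex.Re (\tr (Lambda ^t* *m (Phi - Theta)))
  + rho / 2 * frobenius_norm (Phi - Theta) ^+ 2.

(* unitarymx constrains the rows; here it is the columns that are
   orthonormal. *)
Definition feasible (m n : nat) (Theta : 'M[C]_(m, n)) : Prop :=
  Theta ^t* *m Theta = 1%:M.

Definition optimal_solution (m n : nat) (rho : R)
    (Phi Lambda Theta : 'M[C]_(m, n)) : Prop :=
  feasible Theta /\
  forall Theta' : 'M[C]_(m, n), feasible Theta' ->
    objective rho Phi Lambda Theta <= objective rho Phi Lambda Theta'.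

(* The dimension 2M is written M + M, so that block matrices need no cast. *)
Definition svd_solution (M : nat) (B : 'M[C]_(M + M)) (D : 'M[C]_M) :
    'M[C]_(M + M, M) :=
  B *m (row_mx 1%:M 0)^T *m D ^t*.

End Defs.

(* Main.v *)
Require Import Defs.
From mathcomp Require Import all_boot all_order all_algebra.
From mathcomp Require Import reals complex.
From mathcomp Require Import ring.

Import Order.TTheory GRing.Theory Num.Theory.

(** On the feasible set the quadratic terms are constant, so minimising the
    objective amounts to maximising [Re (tr (A^* Theta))] with
    [A = Lambda + rho Phi].

    If [A = B Sigma D^*] is an SVD, then [tr (A^* Theta) = tr (Sigma^* U)] for
    [U = B^* Theta D], which has orthonormal columns and hence entries of
    modulus at most 1.  The real part is therefore at most the sum of the
    singular values, with equality at [U = [I, 0]^T].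

    Conversely, let [Theta] be a maximiser.  Comparing it with [Q Theta], where
    the unitary [Q] multiplies one vector by a phase and fixes its orthogonal
    complement, shows that [Theta A^*] is positive semidefinite.  Being
    Hermitian, it equals [A Theta^*], so [A = Theta P] with
    [P = A^* Theta] positive semidefinite.  Diagonalising [P = D S D^*]
    and completing the columns of [Theta D] to a unitary [B] gives an SVD of
    [A] whose solution is [Theta]; no existence theorem for SVDs is needed. *)

Set Implicit Arguments.
Unset Strict Implicit.
Unset Printing Implicit Defensive.

Local Open Scope ring_scope.
Local Open Scope complex_scope.
Local Open Scope sesquilinear_scope.

(** * Conjugate transposes, isometries and positive semidefinite matrices *)

Section ConjugateTranspose.
Variable C : numClosedFieldType.

Lemma trmxC_mul m n p (A : 'M[C]_(m, n)) (B : 'M[C]_(n, p)) :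
  (A *m B) ^t* = B ^t* *m A ^t*.
Proof. by rewrite trmx_mul map_mxM. Qed.

Lemma trmxCD m n (A B : 'M[C]_(m, n)) : (A + B) ^t* = A ^t* + B ^t*.
Proof. by rewrite linearD map_mxD. Qed.

Lemma trmxCB m n (A B : 'M[C]_(m, n)) : (A - B) ^t* = A ^t* - B ^t*.
Proof. by rewrite linearB map_mxB. Qed.

Lemma trmxCZ m n (a : C) (A : 'M[C]_(m, n)) :
  (a *: A) ^t* = Num.conj a *: A ^t*.
Proof. by rewrite linearZ map_mxZ. Qed.

Lemma trmxC1 n : (1%:M : 'M[C]_n) ^t* = 1%:M.
Proof. by rewrite trmx1 map_mx1. Qed.

Lemma isometry_trmxC_unitary m n (V : 'M[C]_(m, n)) :
  V ^t* *m V = 1%:M -> V ^t* \is unitarymx.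
Proof. by move=> VV; apply/unitarymxP; rewrite trmxCK. Qed.

Lemma unitary_trmxC_mul n (V : 'M[C]_n) :
  V \is unitarymx -> V ^t* *m V = 1%:M.
Proof. by rewrite -trmxC_unitary => /unitarymxP; rewrite trmxCK. Qed.

(** The orthogonal complement of the row space of [V] has dimension [p]; Gram-Schmidt on a basis of
    it gives [W]. *)
Lemma unitary_completion m p (V : 'M[C]_(m, m + p)) :
  V \is unitarymx -> exists W : 'M[C]_(p, m + p), col_mx V W \is unitarymx.
Proof.
move=> Vu; pose Vo := orthomx Num.conj 1%:M V.
have [W Wu VW] : exists2 W : 'M[C]_(p, m + p), W \is unitarymx & V *m W ^t* = 0.
  (* The rank is generalised to a variable [q], so that [W] gets [p] rows without a cast. *)
  have schmidtVo q : \rank Vo = q ->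
      exists2 W : 'M[C]_(q, m + p), W \is unitarymx & V *m W ^t* = 0.
    move=> <-; exists (schmidt (row_base Vo)).
      by rewrite schmidt_unitarymx // rank_leq_col.
    apply/orthomx1P; rewrite orthomx_sym.
    by rewrite eqmx_schmidt_free ?row_base_free // eq_row_base.
  by apply: schmidtVo; rewrite rank_ortho mxrank_unitary // addKn.
exists W; apply/unitarymxP; rewrite tr_col_mx map_row_mx mul_col_row.
have WV : W *m V ^t* = 0.
  by rewrite -[W]trmxCK -trmxC_mul VW trmx0 map_mx0.
by rewrite VW WV (unitarymxP Vu) (unitarymxP Wu) -scalar_mx_block.
Qed.

Lemma unitary_completion_col m p (V : 'M[C]_(m + p, m)) :
  V ^t* *m V = 1%:M -> exists W : 'M[C]_(m + p, p), row_mx V W \is unitarymx.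
Proof.
move=> /isometry_trmxC_unitary/unitary_completion[W Wu].
exists (W ^t*); rewrite -trmxC_unitary tr_row_mx map_col_mx.
by rewrite trmxCK.
Qed.

(** The squared modulus of the entry is one of the nonnegative terms whose sum, the squared norm of
    column [j], is 1. *)
Lemma isometry_entry_le1 m n (U : 'M[C]_(m, n)) i j :
  U ^t* *m U = 1%:M -> `|U i j| <= 1.
Proof.
move=> /matrixP/(_ j j); rewrite !mxE eqxx => UU.
rewrite -(expr_le1 (n := 2)) // -[leRHS]UU (bigD1 i) //= !mxE mulrC -normCK.
by rewrite lerDl sumr_ge0 // => k _; rewrite !mxE mulrC mul_conjC_ge0.
Qed.

Lemma mxtrace_outer n (u : 'cV[C]_n) (w : 'rV[C]_n) :
  \tr (u *m w) = (w *m u) 0 0.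
Proof. by rewrite mxtrace_mulC /mxtrace big_ord1. Qed.

Lemma normcV2_ge0 n (v : 'cV[C]_n) : 0 <= (v ^t* *m v) 0 0.
Proof.
by rewrite mxE sumr_ge0 // => k _; rewrite !mxE mulrC mul_conjC_ge0.
Qed.

Lemma normcV2_eq0 n (v : 'cV[C]_n) : ((v ^t* *m v) 0 0 == 0) = (v == 0).
Proof.
apply/eqP/eqP => [|->]; last by rewrite mulmx0 mxE.
rewrite mxE => /eqP; rewrite psumr_eq0; last first.
  by move=> k _; rewrite !mxE mulrC mul_conjC_ge0.
move=> /allP v0; apply/matrixP => k l; rewrite ord1 mxE; apply/eqP.
have /implyP/(_ isT) := v0 k (mem_index_enum k).
by rewrite !mxE mulrC mul_conjC_eq0.
Qed.

(* For [`|c| = 1] the matrix [1 - (1 - c) / |v|^2 * v v^*] is the unitary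
   multiplying [v] by [c] and fixing its orthogonal complement. *)
Definition complex_reflection n (c : C) (v : 'cV[C]_n) : 'M[C]_n :=
  1%:M - ((1 - c) / (v ^t* *m v) 0 0) *: (v *m v ^t*).

Lemma complex_reflection_isometry n (c : C) (v : 'cV[C]_n) :
  v != 0 -> c * Num.conj c = 1 ->
  (complex_reflection c v) ^t* *m complex_reflection c v = 1%:M.
Proof.
move=> v0 cc; rewrite /complex_reflection.
set s : C := (v ^t* *m v) 0 0; set a : C := (1 - c) / s.
have s0 : s != 0 by rewrite normcV2_eq0.
have sr : Num.conj s = s.
  by apply/CrealP; apply: ger0_real; apply: normcV2_ge0.
rewrite trmxCB trmxCZ trmxC1 trmxC_mul trmxCK.
rewrite mulmxBl mul1mx !mulmxBr mulmx1 -scalemxAl -scalemxAr.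
have -> : v *m v ^t* *m (v *m v ^t*) = s *: (v *m v ^t*).
  rewrite mulmxA -(mulmxA v) [v ^t* *m v]mx11_scalar -/s.
  by rewrite mul_mx_scalar scalemxAl.
rewrite !scalerA -[RHS]addr0 -addrA; congr (_ + _).
rewrite -scalerBl -opprD -scalerDl -scaleNr.
rewrite [X in - X *: _](_ : _ = 0) ?oppr0 ?scale0r //.
rewrite /a rmorphM rmorphB rmorph1 fmorphV /= sr.
(* Since [v v^*] squares to [s] times itself, this is the total coefficient of [- v v^*] in the
   product; it vanishes for [|c| = 1]. *)
have -> : (1 - c) / s + ((1 - Num.conj c) / s
   - (1 - Num.conj c) / s * ((1 - c) / s) * s) = (1 - c * Num.conj c) / s.
  by field.
by rewrite cc subrr mul0r.
Qed.

Lemma mul_normC_phase (z : C) :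
  exists2 c : C, c * Num.conj c = 1 & c * z = `|z|.
Proof.
have [->|z0] := eqVneq z 0.
  by exists 1; rewrite ?rmorph1 ?mulr1 ?mul1r ?normr0.
have n0 : `|z| != 0 by rewrite normr_eq0.
exists (Num.conj z / `|z|).
  rewrite rmorphM fmorphV /= conjCK [Num.conj `|z|](CrealP _) ?normr_real //.
  rewrite mulrACA [Num.conj z * z]mulrC -normCK -invfM -expr2 divff //.
  by rewrite expf_neq0.
by rewrite mulrAC [Num.conj z * z]mulrC -normCK expr2 mulfK.
Qed.

(** Polarisation: evaluating the form at [e i + a *: e j] shows that
    [a * K i j + Num.conj a * K j i] is real; [a = 1] and [a = 'i] then determine [K j i] from
    [K i j]. *)
Lemma quadratic_real_hermitian n (K : 'M[C]_n) :
  (forall v : 'cV[C]_n, (v ^t* *m K *m v) 0 0 \is Num.real) -> K ^t* = K.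
Proof.
move=> Kr; apply/matrixP => i j.
pose e k : 'cV[C]_n := delta_mx k 0.
have eK k l : ((e k) ^t* *m K *m e l) 0 0 = K k l.
  by rewrite trmx_delta map_delta_mx -rowE -colE !mxE.
have addE (X Y : 'M[C]_1) : (X + Y) 0 0 = X 0 0 + Y 0 0 by rewrite mxE.
have scaleE a (X : 'M[C]_1) : (a *: X) 0 0 = a * X 0 0 by rewrite mxE.
have Kq a : a * K i j + Num.conj a * K j i \is Num.real.
  have := Kr (e i + a *: e j).
  rewrite trmxCD trmxCZ !mulmxDl !mulmxDr -!scalemxAl -!scalemxAr.
  rewrite !(addE, scaleE) !eK.
  have -> : K i i + a * K i j + (Num.conj a * K j i + Num.conj a * (a * K j j)) =
    a * K i j + Num.conj a * K j i + (K i i + `|a| ^+ 2 * K j j).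
    by rewrite normCK; ring.
  rewrite rpredDr // rpredD //.
    by rewrite -eK Kr.
  by rewrite rpredM // ?rpredX ?normr_real // -eK Kr.
rewrite !mxE; move: (Kq 1) (Kq 'i%R).
rewrite conjCi rmorph1 !mul1r => /CrealP h1 /CrealP h2.
move: h1 h2; rewrite !rmorphD !rmorphM rmorphN /= conjCi.
set x := K i j; set y := K j i; set x' := Num.conj x; set y' := Num.conj y.
move=> h1 h2.
have h3 : - x' + y' = x - y.
  apply: (mulfI (neq0Ci C)); rewrite mulrDr mulrBr mulrN.
  by move: h2; rewrite !mulNr opprK.
have : y' *+ 2 = x *+ 2.
  rewrite !mulr2n; transitivity ((x' + y') + (- x' + y')); first by ring.
  by rewrite h1 h3; ring.
by apply: pmulrnI.
Qed.

Lemma psd_spectral n (K : 'M[C]_n) :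
  (forall v : 'cV[C]_n, 0 <= (v ^t* *m K *m v) 0 0) ->
  exists2 D : 'M[C]_n, D \is unitarymx &
  exists2 d : 'rV[C]_n, forall j, 0 <= d 0 j & K = D *m diag_mx d *m D ^t*.
Proof.
move=> Kpos.
have /orthomx_spectralP : K \is normalmx.
  apply/normalmxP; rewrite quadratic_real_hermitian // => v.
  exact: ger0_real.
have Su := spectral_unitarymx K; rewrite invmx_unitary //.
set S := spectralmx K; set d := spectral_diag K => KE.
exists (S ^t*); first by rewrite trmxC_unitary.
exists d => [j|]; last by rewrite trmxCK.
(* Column [j] of [S ^t*] is a unit eigenvector, at which the form takes the value [d 0 j]. *)
have := Kpos (S ^t* *m delta_mx j 0).
rewrite trmxC_mul trmxCK KE !mulmxA !(mulmxtVK _ Su).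
by rewrite trmx_delta map_delta_mx -rowE -colE !mxE eqxx mulr1n.
Qed.

End ConjugateTranspose.

(** * Real parts of traces and reduction to a linear objective *)

Section Procrustes.
Variable R : realType.
Local Notation C := R[i].
Local Notation Re := (@complex.Re R).
Local Notation toC := (real_complex R).

Lemma ReD (x y : C) : Re (x + y) = Re x + Re y.
Proof. by case: x y => [? ?] [? ?]. Qed.

Lemma ReN (x : C) : Re (- x) = - Re x.
Proof. by case: x. Qed.

Lemma Re_realM (a : R) (x : C) : Re (a%:C * x) = a * Re x.
Proof. by case: x => x y /=; rewrite mul0r subr0. Qed.

Lemma Re_conj (x : C) : Re (Num.conj x) = Re x.
Proof. by case: x. Qed.

Lemma Re_sum (I : finType) (F : I -> C) : Re (\sum_i F i) = \sum_i Re (F i).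
Proof. by elim/big_rec2: _ => //= i y x _ <-; rewrite ReD. Qed.

Lemma conj_toC (a : R) : Num.conj a%:C = a%:C.
Proof. exact: conjc_real. Qed.

Lemma Re_ler_norm (x : C) (a : R) : `|x| <= a%:C -> Re x <= a.
Proof.
move=> xa; rewrite -lecR (le_trans _ xa) // (le_trans _ (normc_ge_Re x)) //.
by rewrite lecR ler_norm.
Qed.

Lemma frobenius_norm_sqr m n (X : 'M[C]_(m, n)) :
  frobenius_norm X ^+ 2 = Re (\tr (X ^t* *m X)).
Proof.
rewrite sqr_sqrtr; last first.
  by apply: sumr_ge0 => i _; apply: sumr_ge0 => j _; rewrite sqr_ge0.
rewrite /mxtrace Re_sum exchange_big /=; apply: eq_bigr => j _.
rewrite mxE Re_sum; apply: eq_bigr => i _; rewrite !mxE mulrC -normCK.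
by case: (X i j) => a b; rewrite -add_Re2_Im2 /= sqr_sqrtr ?addr_ge0 ?sqr_ge0.
Qed.

Lemma Re_tr_mulmxC m n (X Y : 'M[C]_(m, n)) :
  Re (\tr (Y ^t* *m X)) = Re (\tr (X ^t* *m Y)).
Proof.
by rewrite -[X in Y ^t* *m X]trmxCK -trmxC_mul trace_map_mx mxtrace_tr Re_conj.
Qed.

(** The constraint turns the squared norm of [Theta] into [n], and the two cross terms of the
    square, having equal real parts, join the linear term. *)
Lemma objective_feasible m n rho (Phi Lambda Theta : 'M[C]_(m, n)) :
  feasible Theta ->
  objective rho Phi Lambda Theta =
  Re (\tr (Lambda ^t* *m Phi)) + rho / 2 * (frobenius_norm Phi ^+ 2 + n%:R)
  - Re (\tr ((Lambda + rho%:C *: Phi) ^t* *m Theta)).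
Proof.
move=> TT; rewrite /objective !frobenius_norm_sqr.
rewrite !trmxCB trmxCD trmxCZ conj_toC !(mulmxBl, mulmxBr, mulmxDl) -scalemxAl.
rewrite opprB !(mxtraceD, mxtraceZ, raddfN) /= !(ReD, ReN) Re_realM TT.
rewrite (Re_tr_mulmxC Phi Theta) mxtrace1.
have -> : Re (n%:R : C) = n%:R by rewrite -(rmorph_nat toC).
by field.
Qed.

(** * Every SVD gives a maximiser *)

Lemma Re_tr_real_mul_le m n (S : 'M[R]_(m, n)) (U : 'M[C]_(m, n)) :
  (forall i j, 0 <= S i j) -> U ^t* *m U = 1%:M ->
  Re (\tr ((map_mx toC S) ^t* *m U)) <= \sum_j \sum_i S i j.
Proof.
move=> S0 UU; rewrite /mxtrace Re_sum; apply: ler_sum => j _.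
rewrite mxE Re_sum; apply: ler_sum => i _; rewrite !mxE.
rewrite conj_toC Re_realM -[leRHS]mulr1 ler_wpM2l //.
by apply: Re_ler_norm; apply: isometry_entry_le1.
Qed.

Lemma Re_tr_diag_mul_eq m p (S : 'M[R]_(m + p, m)) :
  is_diag_mx S ->
  Re (\tr ((map_mx toC S) ^t* *m (row_mx 1%:M 0)^T)) = \sum_j \sum_i S i j.
Proof.
move=> /is_diag_mxP Sd; rewrite /mxtrace Re_sum; apply: eq_bigr => j _.
rewrite mxE Re_sum; apply: eq_bigr => i _; rewrite !mxE.
rewrite conj_toC Re_realM.
case: (split_ordP i) => k -> {i}; rewrite !mxE.
  have [<-|jk] := eqVneq k j; first by rewrite mulr1.
  by rewrite Sd ?mul0r.
(* A row of the bottom block has index at least [m], hence lies off the diagonal. *)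
by rewrite Sd ?mul0r //= gtn_eqF // ltn_addr.
Qed.

Lemma svd_maximizes m p (A Theta : 'M[C]_(m + p, m)) B S D :
  is_svd A B S D -> feasible Theta ->
  Re (\tr (A ^t* *m Theta)) <=
  Re (\tr (A ^t* *m (B *m (row_mx 1%:M 0)^T *m D ^t*))).
Proof.
move=> [Bu Du Sd S0 <-] TT.
(* Cyclicity of the trace moves the unitary factors from [A] onto [X]. *)
have trE X : \tr ((B *m map_mx toC S *m D ^t*) ^t* *m X) =
    \tr ((map_mx toC S) ^t* *m (B ^t* *m X *m D)).
  by rewrite !trmxC_mul trmxCK -!mulmxA mxtrace_mulC !mulmxA.
have BB := unitary_trmxC_mul Bu; have DD := unitary_trmxC_mul Du.
have IE (E : 'M[C]_(m + p, m)) : B ^t* *m (B *m E *m D ^t*) *m D = E.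
  by rewrite !mulmxA BB mul1mx -mulmxA DD mulmx1.
rewrite !trE IE Re_tr_diag_mul_eq //; apply: Re_tr_real_mul_le => //.
rewrite !trmxC_mul trmxCK !mulmxA (mulmxtVK _ Bu).
by rewrite -[D ^t* *m _ *m _]mulmxA TT mulmx1.
Qed.

Lemma svd_solution_feasible M (B : 'M[C]_(M + M)) (D : 'M[C]_M) :
  B \is unitarymx -> D \is unitarymx -> feasible (svd_solution B D).
Proof.
move=> /unitary_trmxC_mul BB /unitarymxP DD.
rewrite /feasible /svd_solution !trmxC_mul trmxCK !mulmxA.
rewrite -[_ *m B ^t* *m B]mulmxA BB mulmx1.
rewrite -[D *m _ *m _]mulmxA trmxK map_row_mx tr_row_mx mul_row_col.
by rewrite map_mx1 map_mx0 trmx1 mulmx1 mul0mx addr0 mulmx1.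
Qed.

(** * Every maximiser comes from an SVD *)

Lemma maximizer_psd m n (A Theta : 'M[C]_(m, n)) :
  feasible Theta ->
  (forall Theta' : 'M[C]_(m, n), feasible Theta' ->
    Re (\tr (A ^t* *m Theta')) <= Re (\tr (A ^t* *m Theta))) ->
  forall v : 'cV[C]_m, 0 <= (v ^t* *m (Theta *m A ^t*) *m v) 0 0.
Proof.
move=> TT Tmax v.
have [->|v0] := eqVneq v 0; first by rewrite mulmx0 mxE.
set z := (_ *m v) 0 0.
(* With this phase, passing to the reflected [Theta] changes the value by [(|z| - Re z) / s];
   maximality forces [|z| <= Re z], so [z] is real and nonnegative. *)
have [c cc cz] := mul_normC_phase z.
have := Tmax (complex_reflection c v *m Theta).
rewrite /feasible trmxC_mul !mulmxA -[_ *m _ *m complex_reflection c v]mulmxA.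
rewrite complex_reflection_isometry // mulmx1 => /(_ TT).
rewrite mulmxBr mulmx1 mulmxBl raddfB /= -scalemxAr -scalemxAl mxtraceZ.
have -> : \tr (A ^t* *m (v *m v ^t*) *m Theta) = z.
  by rewrite mulmxA -mulmxA mxtrace_outer /z !mulmxA.
set s := (v ^t* *m v) 0 0.
have s_gt0 : 0 < s by rewrite lt_def normcV2_eq0 v0 normcV2_ge0.
rewrite ReD ReN gerBl mulrAC mulrBl mul1r cz.
have [t sE] : exists t : R, s = t%:C.
  by apply/complex_realP/ger0_real/ltW.
rewrite sE -fmorphV mulrC Re_realM pmulr_rge0; last first.
  by rewrite invr_gt0 -ltcR -sE.
rewrite ReD ReN subr_ge0 -lecR => zRe.
have zN : `|z| <= (Re z)%:C.
  by apply: le_trans zRe; rewrite RRe_real ?normr_real.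
rewrite complexRe in zN.
by rewrite -(leif_Re_Creal z) eq_le zN (leif_Re_Creal z).
Qed.

Lemma maximizer_svd m p (A Theta : 'M[C]_(m + p, m)) :
  feasible Theta ->
  (forall Theta' : 'M[C]_(m + p, m), feasible Theta' ->
    Re (\tr (A ^t* *m Theta')) <= Re (\tr (A ^t* *m Theta))) ->
  exists B S D, is_svd A B S D /\ Theta = B *m (row_mx 1%:M 0)^T *m D ^t*.
Proof.
move=> TT Tmax; have Kpos := maximizer_psd TT Tmax.
have KH : Theta *m A ^t* = A *m Theta ^t*.
  rewrite -(quadratic_real_hermitian (K := Theta *m A ^t*)).
    by rewrite trmxC_mul trmxCK.
  by move=> v; apply: ger0_real.
have [|D Du [d d0 PE]] := @psd_spectral _ _ (A ^t* *m Theta).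
  (* The form of [A ^t* *m Theta] at [v] is that of [Theta *m A ^t*] at [Theta *m v]. *)
  move=> v; have := Kpos (Theta *m v).
  by rewrite trmxC_mul !mulmxA -[_ *m Theta ^t* *m Theta]mulmxA TT mulmx1.
have AE : A = Theta *m D *m diag_mx d *m D ^t*.
  by rewrite -!mulmxA [D *m _]mulmxA -PE !mulmxA KH -mulmxA TT mulmx1.
have TDTD : (Theta *m D) ^t* *m (Theta *m D) = 1%:M.
  rewrite trmxC_mul mulmxA -[_ *m Theta ^t* *m Theta]mulmxA TT mulmx1.
  exact: unitary_trmxC_mul.
have [W BWu] := unitary_completion_col TDTD.
(* The eigenvalues are nonnegative, so taking real parts loses nothing. *)
pose s : 'rV[R]_m := map_mx Re d.
have sE : map_mx toC s = d.
  apply/matrixP => i j; rewrite !mxE ord1 RRe_real //; exact: ger0_real.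
(* The completing block [W] only ever meets the zero block, both in [Sigma] and in [[I, 0]^T]. *)
exists (row_mx (Theta *m D) W), (col_mx (diag_mx s) 0), D; split.
  split => //.
  - apply/is_diag_mxP => i j ij; rewrite mxE.
    case: split_ordP ij => k -> ij; rewrite mxE //.
    by rewrite (_ : k == j = false) ?mulr0n //; apply/negbTE.
  - move=> i j; rewrite mxE; case: split_ordP => k _; rewrite mxE //.
    case: eqP => [->|_]; rewrite ?mulr0n // mulr1n mxE.
    by have := d0 j; rewrite lecE => /andP[].
  - rewrite map_col_mx map_mx0 map_diag_mx sE mul_row_col mulmx0 addr0.
    by rewrite -AE.
rewrite tr_row_mx trmx1 trmx0 mul_row_col mulmx1 mulmx0 addr0.
by rewrite mulmxtVK.
Qed.

End Procrustes.

(** Minimisers are not unique when [Lambda + rho Phi] is rank deficient, as its SVDs then give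
    different matrices; the formula is therefore shown to describe exactly the set of minimisers. *)
Theorem theorem3 (R : realType) (M : nat) (hM : (1 <= M)%N)
    (rho : R) (hrho : 0 <= rho) (Phi Lambda : 'M[R[i]]_(M + M, M)) :
  (forall (B : 'M[R[i]]_(M + M)) (Sigma : 'M[R]_(M + M, M)) (D : 'M[R[i]]_M),
     is_svd (Lambda + rho%:C *: Phi) B Sigma D ->
     optimal_solution rho Phi Lambda (svd_solution B D))
  /\
  (forall Theta : 'M[R[i]]_(M + M, M),
     optimal_solution rho Phi Lambda Theta ->
     exists (B : 'M[R[i]]_(M + M)) (Sigma : 'M[R]_(M + M, M)) (D : 'M[R[i]]_M),
       is_svd (Lambda + rho%:C *: Phi) B Sigma D /\ Theta = svd_solution B D).
Proof.
split=> [B S D Asvd | Theta [TT Tmin]].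
  have [Bu Du _ _ _] := Asvd.
  have BDf := svd_solution_feasible Bu Du.
  split=> // Theta' T'f; rewrite !objective_feasible // lerB //.
  exact: svd_maximizes Asvd T'f.
apply: maximizer_svd => // Theta' T'f.
by have := Tmin _ T'f; rewrite !objective_feasible // lerD2l lerN2.
Qed.
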